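(* Let $d,\nu,t,m_1,\dots,m_d$ be positive integers with $d\ge 2$, $m_1\ge m_2\ge\cdots\ge m_d\ge t$ and $2\nu\ge 2m_1+m_2+1$. Suppose $\mathcal F_i\subseteq\mathcal P_{m_i}$ ($i=1,\dots,d$) satisfy $\dim(F_1\cap\cdots\cap F_d)\ge t$ for all choices $F_i\in\mathcal F_i$, and that $\prod_{i=1}^d|\mathcal F_i|$ is maximum among all such $d$-tuples of families. Then there exists $T\in\mathcal P_t$ such that $\mathcal F_i=\{F\in\mathcal P_{m_i}: T\subseteq F\}$ for every $i\in\{1,\dots,d\}$.
   Context: Let $q$ be a prime power, $\nu\ge 1$ an integer, and $f$ a non-degenerate alternating bilinear form on $V=\mathbb F_q^{2\nu}$. A subspace $W\le V$ is totally isotropic if $f(x,y)=0$ for all $x,y\in W$ (maximal totally isotropic subspaces have dimension $\nu$). For $0\le m\le \nu$, $\mathcal P_m$ denotes the set of all $m$-dimensional totally isotropic subspaces of $V$. *)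

(* Defs.v *)
From HB Require Import structures.
From mathcomp Require Import all_boot all_order all_algebra all_field.
From mathcomp Require Import finmap.
Set Implicit Arguments. Unset Strict Implicit. Unset Printing Implicit Defensive.
Import GRing.Theory.
Local Open Scope ring_scope.

(* V = F^n as row vectors; a bilinear form on V is given by its Gram matrix A:
   f(x,y) = x A y^T. *)
Definition bform (F : fieldType) (n : nat) (A : 'M[F]_n) (x y : 'rV[F]_n) : F :=
  (x *m A *m y^T) 0 0.

Definition sp_alternating (F : fieldType) (n : nat) (A : 'M[F]_n) : Prop :=
  forall x : 'rV[F]_n, bform A x x = 0.

Definition sp_nondegenerate (F : fieldType) (n : nat) (A : 'M[F]_n) : Prop :=
  A \in unitmx.

Definition tot_isotropic (F : fieldType) (n : nat) (A : 'M[F]_n)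
  (W : {vspace 'rV[F]_n}) : Prop :=
  forall x y, x \in W -> y \in W -> bform A x y = 0.

Definition in_P (F : fieldType) (n : nat) (A : 'M[F]_n) (m : nat)
  (W : {vspace 'rV[F]_n}) : Prop :=
  tot_isotropic A W /\ \dim W = m.

(* Main.v *)
(* Idea.  For two cross-t-intersecting families G (dimension k) and H
   (dimension l), call C a cover of H if it meets every member of H in dimension
   at least t; the members of G are covers of H and conversely.  Let s and r be
   the least dimensions of covers of H and of G, and R a minimal cover of G.
   Every V in G contains one of the at most (2 q^t)^(r-t) t-subspaces of R, and
   a t-subspace that is not yet a cover of H can be enlarged inside V by
   subspaces of a badly met member of H, at a cost of at most 2 q^(l-t) choices
   per dimension, until dimension s is reached.  Together with the symmetric
   bound for H, each extra dimension costs a factor 4 q^l (resp. 4 q^k), and the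
   hypothesis on nu makes this smaller than the gain from the number of
   isotropic spaces above an isotropic space of one dimension more.  Hence
   equality forces s = r = t, and then R lies in all members of both families.
   For d families, multiply the bounds for the cyclically consecutive pairs. *)
Require Import Defs.
From HB Require Import structures.
From mathcomp Require Import all_boot all_order all_algebra all_field.
From mathcomp Require Import finmap.
From mathcomp Require Import zify ring.
Import Order.TTheory GRing.Theory Num.Theory.
Import VectorInternalTheory.
Set Implicit Arguments. Unset Strict Implicit. Unset Printing Implicit Defensive.
Local Open Scope ring_scope.

(** * Finiteness and elementary dimension facts for subspaces *)

HB.instance Definition _ (F : finFieldType) (vT : vectType F) :=
  [Countable of {vspace vT} by <:].
HB.instance Definition _ (F : finFieldType) (vT : vectType F) :=
  [Finite of {vspace vT} by <:].

Lemma union_bound (I X : finType) (B : {set I}) (D : {set X}) (Y : I -> {set X}) :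
  (forall x, x \in D -> exists2 i, i \in B & x \in Y i) ->
  (#|D| <= \sum_(i in B) #|Y i|)%N.
Proof.
move=> DY; apply: (@leq_trans #|\bigcup_(i in B) Y i|).
  by apply/subset_leq_card/subsetP => x /DY[i Bi Yi]; apply/bigcupP; exists i.
elim/big_rec2: _ => [|i m U _ leU]; first by rewrite cards0.
by apply: leq_trans (leq_add (leqnn _) leU); apply: leq_card_setU.
Qed.

Section Vspaces.
Variables (F : fieldType) (vT : vectType F).
Implicit Types (U V W S J : {vspace vT}) (x : vT).

Lemma dim_add_vline S x : x \notin S -> \dim (S + <[x]>) = (\dim S).+1.
Proof.
move=> nSx; have xn0 : x != 0 by apply: contraNneq nSx => ->; rewrite mem0v.
rewrite dimv_disjoint_sum ?dim_vline ?xn0 ?addn1 //.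
apply/eqP; rewrite -subv0; apply/subvP => y /memv_capP[Sy /vlineP[a ya]].
have [a0|an0] := eqVneq a 0; first by rewrite memv0 ya a0 scale0r.
by move: nSx; rewrite -(scalerK an0 x) -ya memvZ.
Qed.

Lemma add_vline_sub S x W : (S + <[x]> <= W)%VS = (S <= W)%VS && (x \in W).
Proof. by rewrite subv_add memvE. Qed.

Lemma exists_mid_subspace J W t : (J <= W)%VS -> (\dim J <= t <= \dim W)%N ->
  exists U, [/\ (J <= U)%VS, (U <= W)%VS & \dim U = t].
Proof.
move=> sJW /andP[]; have [k] := ubnP (t - \dim J).
elim: k J sJW => // k IHk J sJW lk lJ ltW.
have [eJ|nJ] := eqVneq (\dim J) t; first by exists J.
have [x Wx nJx] : exists2 x, x \in W & x \notin J.
  by apply/subvPn; apply/negP => /dimvS; lia.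
have dJx := dim_add_vline nJx.
have [|||//|U [sJU sUW dU]] := IHk (J + <[x]>)%VS; rewrite ?dJx; try lia.
  by rewrite add_vline_sub sJW.
by exists U; split=> //; apply: subv_trans sJU; apply: addvSl.
Qed.

(** Serves to show that a cover of dimension t lies in every member of the family it covers. *)
Lemma subv_of_dim_cap (R V : {vspace vT}) :
  (\dim R <= \dim (R :&: V))%N -> (R <= V)%VS.
Proof.
move=> le; have /eqP <- : (R :&: V)%VS == R by rewrite eqEdim capvSl.
exact: capvSr.
Qed.

End Vspaces.

(** * Orthogonal complements and isotropy *)

Section Perp.
Variables (F : finFieldType) (n : nat) (A : 'M[F]_n).
Implicit Types (U W S T : {vspace 'rV[F]_n}) (x y z : 'rV[F]_n).

Lemma bformDl x y z : bform A (x + y) z = bform A x z + bform A y z.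
Proof. by rewrite /bform !mulmxDl mxE. Qed.

Lemma bformDr x y z : bform A z (x + y) = bform A z x + bform A z y.
Proof. by rewrite /bform linearD /= mulmxDr mxE. Qed.

Lemma bformZl a x y : bform A (a *: x) y = a * bform A x y.
Proof. by rewrite /bform -!scalemxAl mxE. Qed.

Lemma bformZr a x y : bform A x (a *: y) = a * bform A x y.
Proof. by rewrite /bform linearZ /= -scalemxAr mxE. Qed.

Lemma bform_suml I (r : seq I) (P : pred I) (f : I -> 'rV[F]_n) y :
  bform A (\sum_(i <- r | P i) f i) y = \sum_(i <- r | P i) bform A (f i) y.
Proof.
elim/big_rec2: _ => [|i z1 z2 _ <-]; first by rewrite /bform !mul0mx mxE.
exact: bformDl.
Qed.

Definition vbasis_mx U : 'M[F]_(\dim U, n) := \matrix_i (vbasis U)`_i.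

(** Encoded as the kernel of y -> y (B A)^T, with B a basis matrix of [U], so that rank-nullity
    applies. *)
Definition perp U : {vspace 'rV[F]_n} :=
  lker (linfun (mulmxr (vbasis_mx U *m A)^T)).

Lemma perpP U y : reflect (forall x, x \in U -> bform A x y = 0) (y \in perp U).
Proof.
have bE (i : 'I_(\dim U)) :
    bform A (vbasis U)`_i y = (y *m (vbasis_mx U *m A)^T) 0 i.
  rewrite -[in RHS](trmxK y) -trmx_mul [RHS]mxE /bform.
  transitivity ((row i (vbasis_mx U *m A *m y^T)) 0 0); last by rewrite mxE.
  by rewrite !row_mul rowK.
rewrite memv_ker lfunE /=; apply: (iffP eqP) => [yU x Ux | yU].
  rewrite (coord_vbasis Ux) bform_suml big1 // => i _.
  by rewrite bformZl bE yU mxE mulr0.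
apply/rowP => i; rewrite -bE mxE yU // vbasis_mem // mem_nth //.
by rewrite size_tuple.
Qed.

Lemma row_free_vbasis_mx U : row_free (vbasis_mx U).
Proof.
apply: inj_row_free => v; rewrite mulmx_sum_row => v0; apply/rowP => i.
have /freeP/(_ (fun i => v 0 i)) fU := basis_free (vbasisP U).
rewrite fU ?mxE // -[RHS]v0; apply: eq_bigr => j _; by rewrite rowK.
Qed.

(** Non-degeneracy gives B A full row rank, so the map whose kernel is [perp U] is onto. *)
Lemma dim_perp U : A \in unitmx -> (\dim (perp U) + \dim U = n)%N.
Proof.
move=> Au; rewrite /perp; set f := linfun _.
have dV m : \dim {:'rV[F]_m} = m by rewrite dimvf dim_matrix mul1r.
have := limg_ker_dim f fullv; rewrite capfv dV => dE; rewrite -[RHS]dE.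
congr addn; rewrite -[LHS]dV; congr (\dim _).
apply/eqP; rewrite eqEsubv subvf andbT; apply/subvP => y _.
have /row_fullP[D DM] : row_full (vbasis_mx U *m A)^T.
  rewrite -col_leq_rank mxrank_tr mxrankMfree ?row_free_unit //.
  by have := row_free_vbasis_mx U; rewrite -row_leq_rank.
apply/memv_imgP; exists (y *m D); first exact: memvf.
by rewrite lfunE /= -mulmxA DM mulmx1.
Qed.

Hypothesis altA : sp_alternating A.

Lemma bform_skew x y : bform A x y = - bform A y x.
Proof.
have := altA (x + y); rewrite !(bformDl, bformDr) !altA add0r addr0.
by move/eqP; rewrite addr_eq0 => /eqP.
Qed.

Lemma bform_eq0C x y : bform A x y = 0 -> bform A y x = 0.
Proof. by rewrite bform_skew => /eqP; rewrite oppr_eq0 => /eqP. Qed.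

Lemma perpK U : A \in unitmx -> perp (perp U) = U.
Proof.
move=> Au; apply/esym/eqP; rewrite eqEdim; apply/andP; split.
  apply/subvP => x Ux; apply/perpP => y /perpP yU.
  by apply: bform_eq0C; apply: yU.
by have := dim_perp U Au; have := dim_perp (perp U) Au; lia.
Qed.

Lemma perpS U W : (U <= W)%VS -> (perp W <= perp U)%VS.
Proof.
move=> /subvP sUW; apply/subvP => y /perpP yW; apply/perpP => x /sUW.
exact: yW.
Qed.

(** Boolean form of [tot_isotropic], usable in finite set comprehensions. *)
Definition isob W := (W <= perp W)%VS.

Lemma isobP W : reflect (tot_isotropic A W) (isob W).
Proof.
apply: (iffP subvP) => [sW x y Wx /sW/perpP | iW y Wy]; first exact.
by apply/perpP => x Wx; apply: iW.
Qed.

Lemma isobS U W : (U <= W)%VS -> isob W -> isob U.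
Proof.
move=> /subvP sUW /isobP iW; apply/isobP => x y /sUW Wx /sUW Wy; exact: iW.
Qed.

Lemma isob_add_vline S x : isob (S + <[x]>) = isob S && (x \in perp S).
Proof.
apply/idP/andP => [iSx | [/isobP iS /perpP xS]].
  split; first exact: isobS (addvSl _ _) iSx.
  apply/perpP => y Sy; apply: (isobP _ iSx).
    exact: subvP (addvSl _ _) _ Sy.
  exact: subvP (addvSr _ _) _ (memv_line x).
apply/isobP => x1 y1 /memv_addP[s Ss [_ /vlineP[a ->] ->]].
move=> /memv_addP[s' Ss' [_ /vlineP[b ->] ->]].
rewrite !(bformDl, bformDr, bformZl, bformZr) altA iS // xS //.
by rewrite (bform_eq0C (xS _ Ss')) !(mulr0, addr0).
Qed.

End Perp.

(** * Counting subspaces in an interval *)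

Section Counting.
Variables (F : finFieldType) (n : nat).
Implicit Types (U W S T J L : {vspace 'rV[F]_n}) (x : 'rV[F]_n).
Let q := #|F|.

Lemma card_diff_vspace J W : (J <= W)%VS ->
  #|[set x in W | x \notin J]| = (q ^ \dim W - q ^ \dim J)%N.
Proof.
move=> /subvP sJW.
have c (V : {vspace 'rV[F]_n}) : #|[set x in V]| = (q ^ \dim V)%N.
  by rewrite cardsE card_vspace.
rewrite -!c -cardsDS; last by apply/subsetP => x; rewrite !inE => /sJW.
by congr #|pred_of_set _|; apply/setP => x; rewrite !inE andbC.
Qed.

(* Counts the pairs (W, x) with x in W but not in J. *)
Lemma double_count (P : pred {vspace 'rV[F]_n}) J b :
    (forall W, P W -> (J <= W)%VS /\ \dim W = b) ->
  (#|[set W | P W]| * (q ^ b - q ^ \dim J) =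
   \sum_(x | x \notin J) #|[set W | P W & (J + <[x]> <= W)%VS]|)%N.
Proof.
move=> PJ; rewrite -sum_nat_const.
transitivity (\sum_(W in [set W | P W]) \sum_(x | (x \in W) && (x \notin J)) 1)%N.
  apply: eq_bigr => W; rewrite inE => /PJ[sJW <-].
  by rewrite -card_diff_vspace // -sum1_card; apply: eq_bigl => x; rewrite inE.
rewrite (exchange_big_dep (fun x => x \notin J)) /=; last first.
  by move=> W x _ /andP[].
apply: eq_bigr => x nJx; rewrite -sum1_card; apply: eq_bigl => W.
rewrite !inE add_vline_sub nJx andbT.
by case PW: (P W) => //=; have [-> _] := PJ _ PW.
Qed.

Lemma card_field_gt1 : (1 < q)%N.
Proof. exact: finNzRing_gt1. Qed.

Definition between J L b :=
  [set W : {vspace 'rV[F]_n} | [&& (J <= W)%VS, (W <= L)%VS & \dim W == b]].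

(** As j < b and q >= 2, the term 2 q^(l-b+j) is at most q^l. All factors 2 in the later bounds come
    from here. *)
Lemma expn_diff_bound j b l : (j < b <= l)%N ->
  (q ^ l - q ^ j <= 2 * q ^ (l - b) * (q ^ b - q ^ j))%N.
Proof.
move=> /andP[ltjb lebl]; have q1 := card_field_gt1.
rewrite mulnBr -mulnA -expnD subnK // -mulnA -expnD.
have : (2 * q ^ (l - b + j) <= q ^ l)%N.
  apply: (@leq_trans (q ^ (l - b + j).+1)%N).
    by rewrite expnS leq_mul2r q1 orbT.
  by rewrite leq_exp2l //; lia.
lia.
Qed.

(** Induction on b - dim J by double counting: each x in [L] outside [J] leads to the interval above
    J + <[x]>, and [expn_diff_bound] prices one dimension. *)
Lemma card_between J L b : (J <= L)%VS -> (\dim J <= b <= \dim L)%N ->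
  (#|between J L b| <= (2 * q ^ (\dim L - b)) ^ (b - \dim J))%N.
Proof.
have q1 := card_field_gt1.
move=> sJL /andP[]; have [k] := ubnP (b - \dim J).
elim: k J sJL => // k IHk J sJL lek leJ leL.
have [eJ|nJ] := eqVneq (\dim J) b.
  rewrite eJ subnn expn0; apply: (@leq_trans #|[set J]|); last by rewrite cards1.
  apply/subset_leq_card/subsetP => W.
  by rewrite !inE => /and3P[sJW _ /eqP dW]; rewrite eq_sym eqEdim sJW dW eJ /=.
have ltJ : (\dim J < b)%N by lia.
have pos : (0 < q ^ b - q ^ \dim J)%N by rewrite subn_gt0 ltn_exp2l.
rewrite -(leq_pmul2r pos) double_count; last first.
  by move=> W /and3P[? _ /eqP].
have -> : (b - \dim J = (b - (\dim J).+1).+1)%N by lia.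
set B := (2 * _)%N; set e := (b - _.+1)%N.
apply: (@leq_trans (\sum_(x in [set x in L | x \notin J]) B ^ e)%N).
  rewrite [X in (_ <= X)%N](big_setID [set x | x \notin J]) /=.
  rewrite (bigID (mem L)) /= addnC big1 ?add0n; last first.
    move=> x /andP[_ nLx]; apply/eqP; rewrite cards_eq0 -subset0.
    apply/subsetP => W; rewrite !inE add_vline_sub => /andP[/and3P[_ sWL _]].
    by move=> /andP[_ /(subvP sWL)]; rewrite (negbTE nLx).
  apply: leq_trans (leq_addr _ _).
  rewrite [X in (_ <= X)%N](eq_bigl (fun x => (x \notin J) && (x \in L))); last first.
    by move=> x; rewrite !inE; case: (x \in J); case: (x \in L).
  apply: leq_sum => x /andP[nJx Lx]; have dJx := dim_add_vline nJx.
  have := IHk (J + <[x]>)%VS; rewrite dJx add_vline_sub sJL => /(_ Lx).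
  move=> /(_ _ ltJ leL); rewrite -/B -/e => IH.
  apply: leq_trans (IH _); last by lia.
  apply/subset_leq_card/subsetP => W; rewrite !inE => /andP[/and3P[_ -> ->] ->].
  by [].
rewrite sum_nat_const card_diff_vspace // expnS mulnAC leq_mul2r.
by rewrite expn_diff_bound ?orbT // ltJ.
Qed.

(* The number of isotropic k-spaces above a given isotropic i-space. *)
Definition nstar k i : rat :=
  \prod_(i <= j < k) ((q%:R ^+ (n - j) - q%:R ^+ j) / (q%:R ^+ k - q%:R ^+ j)).

(** * Estimates for [nstar] *)

Lemma natr_expn_sub a b : (b <= a)%N ->
  (q ^ a - q ^ b)%:R = q%:R ^+ a - q%:R ^+ b :> rat.
Proof.
by move=> leba; rewrite natrB ?natrX // leq_pexp2l // ltnW // card_field_gt1.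
Qed.

Lemma nstar_gt0 k i : (2 * k <= n)%N -> 0 < nstar k i.
Proof.
have q1 := card_field_gt1; move=> le2k.
rewrite /nstar big_nat_cond; apply: prodr_gt0 => j /andP[/andP[_ ltjk] _].
by rewrite divr_gt0 // subr_gt0 ltr_eXn2l ?ltr1n //; lia.
Qed.

(** The ratio of the two values is (q^(n-i) - q^i) / (q^k - q^i); it exceeds q^e because q^(e+k) <=
    q^(n-i) and q^(e+i) > q^i. *)
Lemma nstar_step k i e : (2 * k <= n)%N -> (i < k)%N -> (0 < e)%N ->
  (e + k + i <= n)%N -> q%:R ^+ e * nstar k i.+1 < nstar k i.
Proof.
have q1 := card_field_gt1; move=> le2k ltik e_gt0 len.
rewrite [ltRHS]/nstar big_ltn // -/(nstar k i.+1) ltr_pM2r ?nstar_gt0 //.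
have lt_exp a b : (a < b)%N -> q%:R ^+ a < q%:R ^+ b :> rat.
  by move=> ?; rewrite ltr_eXn2l ?ltr1n.
rewrite ltr_pdivlMr ?subr_gt0 ?lt_exp // mulrBr -!exprD.
apply: ler_ltB; first by rewrite ler_eXn2l ?ltr1n //; lia.
by apply: lt_exp; lia.
Qed.

(** Take e = l + 2, so that 4 q^l <= q^e. In the worst case i = k - 1, the condition e + k + i <= n
    is exactly 2k + l + 1 <= n. *)
Lemma nstar_step_cross k l i : (2 * k + l + 1 <= n)%N -> (i < k)%N ->
  (4 * q ^ l)%:R * nstar k i.+1 < nstar k i.
Proof.
have q1 := card_field_gt1; move=> len ltik.
have := @nstar_step k i (l + 2) _ ltik _ _; rewrite -natrX => H.
apply: le_lt_trans (H _ _ _); try lia.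
rewrite ler_pM2r ?nstar_gt0 //; last by lia.
rewrite ler_nat expnD mulnC leq_mul2l -[4%N]/(2 ^ 2)%N leq_exp2r // q1.
by rewrite orbT.
Qed.

Lemma nstar_weight_le k l i j (c : rat) : (2 * k + l + 1 <= n)%N ->
  0 <= c <= (4 * q ^ l)%:R -> (i <= j <= k)%N ->
  c ^+ j * nstar k j <= c ^+ i * nstar k i.
Proof.
move=> len /andP[c0 lec] /andP[]; elim: j => [|j IHj]; first by rewrite leqn0 => /eqP->.
rewrite leq_eqVlt => /predU1P[-> //|leij] ltjk.
apply: le_trans (IHj leij (ltnW ltjk)); rewrite exprSr -mulrA.
rewrite ler_wpM2l ?exprn_ge0 //; apply: le_trans (ltW (nstar_step_cross len ltjk)).
by rewrite ler_wpM2r // ltW // nstar_gt0 //; lia.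
Qed.

(** The step from t to t + 1 is strict; the remaining ones are weak. Multiplying by the t-th power
    of the factor matches the form of [nstar_weight_le]. *)
Lemma nstar_weight_lt k l t s : (2 * k + l + 1 <= n)%N -> (t < s <= k)%N ->
  (4 * q ^ l)%:R ^+ (s - t) * nstar k s < nstar k t.
Proof.
have q1 := card_field_gt1.
have d_gt0 : 0 < (4 * q ^ l)%:R :> rat by rewrite ltr0n muln_gt0 expn_gt0 (ltnW q1).
move=> len /andP[ltts lesk]; have lttk := leq_trans ltts lesk.
apply: le_lt_trans (nstar_step_cross len lttk).
rewrite -(ler_pM2l (exprn_gt0 t d_gt0)) mulrA -exprD subnKC ?(ltnW ltts) //.
rewrite mulrA -exprSr; apply: (nstar_weight_le len) => //; first by rewrite ltW /=.
by rewrite ltts.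
Qed.

(** The [leif] form keeps track of equality when two such bounds are multiplied in [cross_pair]. *)
Lemma nstar_weight_leif k l t s : (2 * k + l + 1 <= n)%N -> (t <= s <= k)%N ->
  (4 * q ^ l)%:R ^+ (s - t) * nstar k s <= nstar k t ?= iff (s == t).
Proof.
move=> len /andP[lets lesk]; case: eqVneq => [->|nst].
  by split; rewrite subnn expr0 mul1r ?eqxx.
have lt := @nstar_weight_lt k l t s len; split; first by rewrite ltW // lt //; lia.
by rewrite lt_eqF // lt //; lia.
Qed.

(** * Isotropic subspaces and stars *)

Variable A : 'M[F]_n.
Hypotheses (altA : sp_alternating A) (Au : A \in unitmx).

Definition isotropics k := [set W : {vspace 'rV[F]_n} | isob A W & \dim W == k].

Definition star k S := [set W in isotropics k | (S <= W)%VS].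

Lemma isob_dim W : isob A W -> (2 * \dim W <= n)%N.
Proof. by move=> /dimvS; have := dim_perp W Au; lia. Qed.

(** Double counting of pairs (W, x) with x in W outside [S]: x contributes nothing outside
    [perp A S], and otherwise S + <[x]> is isotropic and induction on k - dim S applies. *)
Lemma card_star k S : (2 * k <= n)%N -> isob A S -> (\dim S <= k)%N ->
  #|star k S|%:R = nstar k (\dim S).
Proof.
have q1 := card_field_gt1; move=> le2k.
have [m] := ubnP (k - \dim S); elim: m S => // m IHm S lem iS leS.
have [eS|nS] := eqVneq (\dim S) k.
  rewrite /nstar eS big_geq //.
  have -> : star k S = [set S]; last by rewrite cards1.
  apply/setP => W; rewrite !inE; apply/idP/eqP => [/andP[/andP[_ /eqP dW] sSW]|->].
    by apply/esym/eqP; rewrite eqEdim sSW dW eS /=.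
  by rewrite iS eS eqxx subvv.
have ltS : (\dim S < k)%N by lia.
have pos : (0 < q ^ k - q ^ \dim S)%N by rewrite subn_gt0 ltn_exp2l.
have dimP := dim_perp S Au; have leP := isob_dim iS.
rewrite /nstar big_ltn // -/(nstar k (\dim S).+1).
rewrite -!natr_expn_sub; try lia.
have nz : (q ^ k - q ^ \dim S)%:R != 0 :> rat by rewrite pnatr_eq0 -lt0n.
rewrite mulrAC; apply: (canRL (mulfK nz)); rewrite -natrM.
have -> : star k S = [set W | W \in star k S] by apply/setP => W; rewrite inE.
rewrite (double_count (b := k)); last first.
  by move=> W; rewrite !inE => /andP[/andP[_ /eqP]].
rewrite (bigID (mem (perp A S))) /= [X in (_ + X)%N]big1 ?addn0; last first.
  move=> x /andP[_ nPx]; apply/eqP; rewrite cards_eq0 -subset0.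
  apply/subsetP => W; rewrite !inE => /andP[/andP[/andP[iW _] _]] sSx.
  by case/negP: nPx; have := isobS sSx iW; rewrite isob_add_vline // => /andP[].
have -> : (n - \dim S = \dim (perp A S))%N by lia.
rewrite -card_diff_vspace // natr_sum mulrC mulr_natr -sumr_const.
rewrite (eq_bigl (fun x => x \in [set x in perp A S | x \notin S])); last first.
  by move=> x; rewrite inE andbC.
apply: eq_bigr => x; rewrite inE => /andP[Px nSx].
rewrite -(dim_add_vline nSx) -IHm ?dim_add_vline ?isob_add_vline ?iS //; try lia.
congr (#|pred_of_set _|%:R); apply/setP => W; rewrite !inE add_vline_sub.
by case: (S <= W)%VS; rewrite ?andbF ?andbT.
Qed.

(* U |-> U^perp turns subspaces of R into superspaces of R^perp, so the sandwich
   bound applies in codimension. *)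
Lemma card_subspaces R t : (t <= \dim R)%N ->
  (#|between 0%VS R t| <= (2 * q ^ t) ^ (\dim R - t))%N.
Proof.
move=> leR.
have dP U := dim_perp U Au.
have dV : \dim {:'rV[F]_n} = n by rewrite dimvf dim_matrix mul1r.
have := @card_between (perp A R) fullv (n - t) (subvf _) _.
rewrite dV => H; have dR := dP R.
have -> : (\dim R - t = n - t - \dim (perp A R))%N by lia.
rewrite -[in (2 * q ^ t)%N](_ : n - (n - t) = t)%N; last by lia.
apply: leq_trans (H _); last by lia.
have inj : injective (perp A) by apply: can_inj (fun U => perpK altA U Au).
rewrite -(card_imset _ inj); apply/subset_leq_card/subsetP => _ /imsetP[U + ->].
rewrite !inE => /and3P[_ sUR /eqP dU]; rewrite perpS // subvf /=.
by apply/eqP; have := dP U; lia.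
Qed.

(** * Covers and cross-intersecting families *)

Definition covers t (G : {set {vspace 'rV[F]_n}}) S :=
  [forall W in G, (t <= \dim (S :&: W))%N].

Lemma coversP t (G : {set {vspace 'rV[F]_n}}) S :
  reflect (forall W, W \in G -> (t <= \dim (S :&: W))%N) (covers t G S).
Proof. exact: forall_inP. Qed.

Definition cross t (G H : {set {vspace 'rV[F]_n}}) :=
  forall V W, V \in G -> W \in H -> (t <= \dim (V :&: W))%N.

(* If S meets W in H in J with dim J < t, then any V in G above S contains S + U
   for some U with J <= U <= W and dim U = t; recurse on S + U. *)
Lemma card_above_le (G H : {set {vspace 'rV[F]_n}}) k l t s S (c : rat) :
    c = (2 * q ^ (l - t))%:R ->
    G \subset isotropics k -> H \subset isotropics l -> cross t G H ->
    (t <= l)%N -> (2 * k + l + 1 <= n)%N -> (s <= k)%N ->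
    (forall C, covers t H C -> (S <= C)%VS -> (s <= \dim C)%N) ->
  #|[set V in G | (S <= V)%VS]|%:R * c ^+ \dim S <= c ^+ s * nstar k s.
Proof.
have q1 := card_field_gt1.
move=> cE sGk sHl GH letl len lesk; have [m] := ubnP (k.+1 - \dim S).
elim: m S => // m IHm S lem Smin.
have c_gt0 : 0 < c by rewrite cE ltr0n muln_gt0 expn_gt0 (ltnW q1).
have lec : 0 <= c <= (4 * q ^ l)%:R.
  by rewrite (ltW c_gt0) cE ler_nat leq_mul // leq_pexp2l ?leq_subr // (ltnW q1).
have le2k : (2 * k <= n)%N by clear -len; lia.
(* A member above [S] gives dim S <= k, which the recursion on k + 1 - dim S needs in order to
   descend. *)
case: (set_0Vmem [set V in G | (S <= V)%VS]) => [->|[V0]].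
  by rewrite cards0 mul0r mulr_ge0 ?exprn_ge0 ?ltW ?nstar_gt0.
rewrite inE => /andP[GV0 sSV0].
have := subsetP sGk _ GV0; rewrite inE => /andP[iV0 /eqP dV0].
have leS : (\dim S <= k)%N by rewrite -dV0 dimvS.
(* Beyond the threshold s, the full star above [S] is a good enough bound, since the weights do not
   increase with the dimension. *)
case: (leqP s (\dim S)) => [lesS|ltSs].
  apply: le_trans (nstar_weight_le len lec (_ : s <= \dim S <= k)%N).
    rewrite mulrC ler_pM2l ?exprn_gt0 // -card_star //; last exact: isobS iV0.
    rewrite ler_nat; apply/subset_leq_card/subsetP => V.
    by rewrite !inE => /andP[/(subsetP sGk)]; rewrite inE => -> ->.
  by rewrite lesS.
have /forall_inPn[W HW] : ~~ covers t H S.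
  by apply/negP => /Smin/(_ (subvv _)); rewrite leqNgt ltSs.
rewrite -ltnNge => ltj; set J := (S :&: W)%VS in ltj.
have := subsetP sHl _ HW; rewrite inE => /andP[iW /eqP dW].
have leB : (#|between J W t| <= (2 * q ^ (l - t)) ^ (t - \dim J))%N.
  by rewrite -dW; apply: card_between; rewrite ?capvSr // (ltnW ltj) dW.
have leU := @union_bound _ _ (between J W t) [set V in G | (S <= V)%VS]
  (fun U => [set V in G | (S + U <= V)%VS]).
have {}leU : (#|[set V in G | (S <= V)%VS]| <=
    \sum_(U in between J W t) #|[set V in G | (S + U <= V)%VS]|)%N.
  apply: leU => V; rewrite inE => /andP[GV sSV].
  have [||U [sJU sUVW dU]] := @exists_mid_subspace _ _ J (V :&: W)%VS t.
  - by rewrite capvS.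
  - by rewrite (ltnW ltj) GH.
  have [sUV sUW] : (U <= V)%VS /\ (U <= W)%VS by apply/andP; rewrite -subv_cap.
  by exists U; rewrite inE ?sJU ?sUW ?dU ?eqxx // GV subv_add sSV.
have step U : U \in between J W t ->
    c ^+ (t - \dim J) * (#|[set V in G | (S + U <= V)%VS]|%:R * c ^+ \dim S)
      <= c ^+ s * nstar k s.
  rewrite inE => /and3P[sJU sUW /eqP dU].
  (* Hence S + U gains exactly t - dim J dimensions, the same exponent of c that bounds the number
     of choices of [U]. *)
  have eSU : (S :&: U)%VS = J.
    apply/eqP; rewrite eqEsubv subv_cap capvSl sJU /= andbT.
    by rewrite subv_cap capvSl (subv_trans (capvSr _ _) sUW).
  have := dimv_sum_cap S U; rewrite eSU dU => dSU.
  have dJ : (\dim J <= \dim S)%N by rewrite dimvS // capvSl.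
  rewrite mulrCA -exprD.
  have dE : (t - \dim J + \dim S = \dim (S + U))%N.
    rewrite -(addnK (\dim J) (\dim (S + U))) dSU -addnBA ?(ltnW ltj) //.
    by rewrite addnC.
  rewrite dE.
  apply: IHm; first by rewrite -dE; clear -lem ltj leS; lia.
  by move=> C /Smin + sSUC; apply; apply: subv_trans sSUC; apply: addvSl.
rewrite -(ler_pM2l (exprn_gt0 (t - \dim J) c_gt0)).
apply: (@le_trans _ _ (\sum_(U in between J W t) (c ^+ s * nstar k s))).
  apply: le_trans (ler_sum _ step); rewrite -mulr_sumr -mulr_suml.
  rewrite ler_pM2l ?exprn_gt0 // ler_pM2r ?exprn_gt0 // -natr_sum ler_nat.
  exact: leU.
rewrite sumr_const -mulr_natl ler_pM2r ?mulr_gt0 ?exprn_gt0 ?nstar_gt0 //.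
by rewrite cE -natrX ler_nat.
Qed.


(** Every V in [G] contains a t-subspace U of [R]. Sum over all such U, bounding the members above U
    by [card_above_le] divided by c^t. *)
Lemma cross_card_le (G H : {set {vspace 'rV[F]_n}}) k l t s R :
    G \subset isotropics k -> H \subset isotropics l -> cross t G H ->
    (t <= l)%N -> (2 * k + l + 1 <= n)%N -> (t <= s <= k)%N ->
    (forall C, covers t H C -> (s <= \dim C)%N) ->
    covers t G R -> (t <= \dim R)%N ->
  #|G|%:R <= (2 * q ^ t)%:R ^+ (\dim R - t) *
             ((2 * q ^ (l - t))%:R ^+ (s - t) * nstar k s).
Proof.
have q1 := card_field_gt1.
move=> sGk sHl GH letl len /andP[lets lesk] smin /coversP covR letR.
have [c cE] : exists c : rat, c = (2 * q ^ (l - t))%:R by eexists.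
have c_gt0 : 0 < c by rewrite cE ltr0n muln_gt0 expn_gt0 (ltnW q1).
rewrite -cE.
have leG : (#|G| <= \sum_(U in between 0%VS R t) #|[set V in G | (U <= V)%VS]|)%N.
  apply: union_bound => V GV.
  have [||U [_ sURV dU]] := @exists_mid_subspace _ _ 0%VS (R :&: V)%VS t.
  - exact: sub0v.
  - by rewrite dimv0 covR.
  have [sUR sUV] : (U <= R)%VS /\ (U <= V)%VS by apply/andP; rewrite -subv_cap.
  by exists U; rewrite inE ?sub0v ?sUR ?dU ?eqxx // GV.
have step U : U \in between 0%VS R t ->
    #|[set V in G | (U <= V)%VS]|%:R <= c ^+ (s - t) * nstar k s.
  rewrite inE => /and3P[_ _ /eqP dU].
  have := card_above_le (S := U) cE sGk sHl GH letl len lesk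
    (fun C covC _ => smin C covC).
  rewrite dU -{1}(subnK lets) exprD mulrAC.
  by rewrite ler_pM2r // exprn_gt0.
move: leG; rewrite -(ler_nat rat) natr_sum => /le_trans; apply.
apply: le_trans (ler_sum _ step) _; rewrite sumr_const -[leLHS]mulr_natl.
rewrite ler_wpM2r //.
  by rewrite mulr_ge0 ?exprn_ge0 ?ltW ?nstar_gt0 //; clear -len; lia.
by rewrite -natrX ler_nat card_subspaces.
Qed.

(* If R did not cover H, the covers of H above R would have dimension > t, and
   card_above_le from R itself would make G strictly smaller than a star. *)
Lemma common_subspace (G H : {set {vspace 'rV[F]_n}}) k l t R V0 :
    G \subset isotropics k -> H \subset isotropics l -> cross t G H ->
    (t <= l)%N -> (2 * k + l + 1 <= n)%N -> (t <= k)%N ->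
    V0 \in G -> \dim R = t -> covers t G R -> nstar k t <= #|G|%:R ->
  covers t H R.
Proof.
have q1 := card_field_gt1.
move=> sGk sHl GH letl len letk GV0 dR /coversP covR; apply: contraTT => nR.
have RG V : V \in G -> (R <= V)%VS.
  by move=> /covR; rewrite -{1}dR; apply: subv_of_dim_cap.
have Rmin C : covers t H C -> (R <= C)%VS -> (t.+1 <= \dim C)%N.
  move=> covC sRC; rewrite ltnNge; apply: contra nR => leC.
  by have /eqP -> : R == C by rewrite eqEdim sRC dR.
(* [V0] is itself a cover of [H] above [R], so its dimension k exceeds t. *)
have ltk : (t < k)%N.
  have := subsetP sGk _ GV0; rewrite inE => /andP[_ /eqP <-].
  by apply: Rmin (RG _ GV0); apply/coversP => W; apply: GH.
have := card_above_le (erefl _) sGk sHl GH letl len ltk Rmin.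
have -> : [set V in G | (R <= V)%VS] = G.
  by apply/setP => V; rewrite inE; apply: andb_idr; apply: RG.
set c : rat := (2 * q ^ (l - t))%:R.
have c_gt0 : 0 < c by rewrite ltr0n muln_gt0 expn_gt0 (ltnW q1).
rewrite dR exprSr -mulrA mulrC ler_pM2l ?exprn_gt0 // => leG.
rewrite -ltNge; apply: le_lt_trans leG _.
apply: le_lt_trans (nstar_step_cross len ltk).
rewrite ler_wpM2r //.
  by rewrite ltW // nstar_gt0 //; clear -len; lia.
by rewrite ler_nat leq_mul // leq_pexp2l ?leq_subr // ltnW.
Qed.


(** [S] and [R] are covers of least dimension of [H] and [G] respectively; each enters both
    cardinality bounds, once as threshold and once as the space whose t-subspaces are listed. *)
Lemma cross_pair (G H : {set {vspace 'rV[F]_n}}) k l t V0 W0 :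
    G \subset isotropics k -> H \subset isotropics l -> cross t G H ->
    (t <= k)%N -> (t <= l)%N ->
    (2 * k + l + 1 <= n)%N -> (2 * l + k + 1 <= n)%N ->
    V0 \in G -> W0 \in H ->
  (#|G|%:R * #|H|%:R <= nstar k t * nstar l t) /\
  (nstar k t * nstar l t <= #|G|%:R * #|H|%:R ->
   exists T, [/\ isob A T, \dim T = t, G = star k T & H = star l T]).
Proof.
move=> sGk sHl GH letk letl lenk lenl GV HW.
have HG : cross t H G by move=> W V HW' GV'; rewrite capvC; apply: GH.
have covG V : V \in G -> covers t H V.
  by move=> GV'; apply/coversP => W; apply: GH.
have covH W : W \in H -> covers t G W.
  by move=> HW'; apply/coversP => V; apply: HG.
have dG V : V \in G -> \dim V = k by move/(subsetP sGk); rewrite inE => /andP[_ /eqP].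
have dH W : W \in H -> \dim W = l by move/(subsetP sHl); rewrite inE => /andP[_ /eqP].
have [S covS Smin] := arg_minnP (fun C : {vspace 'rV[F]_n} => \dim C) (covG _ GV).
have [R covR Rmin] := arg_minnP (fun C : {vspace 'rV[F]_n} => \dim C) (covH _ HW).
have letS : (t <= \dim S)%N.
  exact: leq_trans (coversP _ _ _ covS _ HW) (dimvS (capvSl _ _)).
have letR : (t <= \dim R)%N.
  exact: leq_trans (coversP _ _ _ covR _ GV) (dimvS (capvSl _ _)).
have leSk : (t <= \dim S <= k)%N by rewrite letS -(dG _ GV) Smin ?covG.
have leRl : (t <= \dim R <= l)%N by rewrite letR -(dH _ HW) Rmin ?covH.
have leG := cross_card_le sGk sHl GH letl lenk leSk Smin covR letR.
have leH := cross_card_le sHl sGk HG letk lenl leRl Rmin covS letS.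
have pos k' j : (2 * k' + 1 <= n)%N -> 0 < nstar k' j.
  by move=> le; apply: nstar_gt0; clear -le; lia.
have posk j : 0 < nstar k j by apply: pos; clear -lenk; lia.
have posl j : 0 < nstar l j by apply: pos; clear -lenl; lia.
have split4 j : (t <= j)%N -> (2 * q ^ t * (2 * q ^ (j - t)) = 4 * q ^ j)%N.
  by move=> letj; rewrite mulnACA -expnD subnKC.
have leP := leif_pM _ _ (nstar_weight_leif lenk leSk) (nstar_weight_leif lenl leRl).
(* Regroup by exponent: 2 q^t from one bound meets 2 q^(l-t) or 2 q^(k-t) from the other, giving 4
   q^l and 4 q^k. *)
have leGH : #|G|%:R * #|H|%:R <=
    ((4 * q ^ l)%:R ^+ (\dim S - t) * nstar k (\dim S)) *
    ((4 * q ^ k)%:R ^+ (\dim R - t) * nstar l (\dim R)).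
  apply: le_trans (ler_pM _ _ leG leH) _; rewrite ?ler0n //.
  rewrite -!split4 // !natrM !exprMn le_eqVlt; apply/orP; left; apply/eqP; ring.
have {}leP := leP (mulr_ge0 (exprn_ge0 _ (ler0n _ _)) (ltW (posk _)))
  (mulr_ge0 (exprn_ge0 _ (ler0n _ _)) (ltW (posl _))).
split; first exact: le_trans leGH leP.
move=> geGH.
have /andP[/eqP eS /eqP eR] : (\dim S == t) && (\dim R == t).
  (* Equality of products could also come from a zero bound; positivity excludes it. *)
  have nn0 : (nstar k t * nstar l t == 0) = false by rewrite gt_eqF ?mulr_gt0.
  have := leP.2; rewrite nn0 /= => <-.
  by rewrite eq_le leP.1 (le_trans geGH leGH).
move: leG leH; rewrite eS eR subnn !expr0 !mul1r => leG leH.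
(* Both sizes are bounded above by their star sizes, so the bound on the product forces each to
   attain its own. *)
have geG : nstar k t <= #|G|%:R.
  by rewrite -(ler_pM2r (posl t)) (le_trans geGH) // ler_wpM2l.
have geH : nstar l t <= #|H|%:R.
  by rewrite -(ler_pM2l (posk t)) (le_trans geGH) // ler_wpM2r.
have covHR := common_subspace sGk sHl GH letl lenk letk GV eR covR geG.
have sub K T : covers t K R -> T \in K -> (R <= T)%VS.
  by move=> /coversP/[apply]; rewrite -{1}eR; apply: subv_of_dim_cap.
have iR : isob A R.
  have := subsetP sGk _ GV; rewrite inE => /andP[iV _].
  exact: isobS (sub _ _ covR GV) iV.
exists R; split=> //; apply/eqP; rewrite eqEcard; apply/andP; split.
- by apply/subsetP => V GV'; rewrite inE (subsetP sGk) // (sub _ _ covR).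
- by rewrite -(ler_nat rat) card_star ?eR //; clear -lenk; lia.
- by apply/subsetP => V HV'; rewrite inE (subsetP sHl) // (sub _ _ covHR).
- by rewrite -(ler_nat rat) card_star ?eR //; clear -lenl; lia.
Qed.

(** If x lies in [T] but not in [S], every member of the star of [S] contains S + <[x]>,
    contradicting the strict drop of [nstar] (case e = 1). *)
Lemma star_inj k S T : (2 * k + 1 <= n)%N -> isob A S -> isob A T ->
  (\dim S <= k)%N -> \dim S = \dim T -> star k S = star k T -> S = T.
Proof.
move=> lek iS iT leS dST eST; apply/eqP; rewrite eq_sym eqEdim dST leqnn andbT.
apply/negPn/negP => nTS.
have [x Tx nSx] : exists2 x, x \in T & x \notin S by apply/subvPn.
have dSx := dim_add_vline nSx.
have sub W : W \in star k S -> W \in star k (S + <[x]>)%VS.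
  move=> WS; move: (WS); rewrite eST !inE add_vline_sub => /andP[-> sTW].
  by move: WS; rewrite inE => /andP[_ ->]; rewrite (subvP sTW).
have le2k : (2 * k <= n)%N by lia.
have pos : 0 < nstar k (\dim S) by exact: nstar_gt0.
have [W SW] : exists W, W \in star k S.
  by apply/card_gt0P; rewrite -(ltr0n rat) card_star.
have := sub _ SW; rewrite !inE => /andP[/andP[iW /eqP dW] sSxW].
have ltS : (\dim S < k)%N by rewrite -dSx -dW dimvS.
have : nstar k (\dim S) <= nstar k (\dim S).+1.
  rewrite -dSx -!card_star ?dSx //; last exact: isobS iW.
  by rewrite ler_nat; apply/subset_leq_card/subsetP.
apply/negP; rewrite -ltNge; apply: le_lt_trans (nstar_step le2k ltS (e := 1) _ _) => //.
  by rewrite ler_peMl ?expr1 ?ler1n ?(ltnW card_field_gt1) // ltW // nstar_gt0.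
by clear -lek ltS; lia.
Qed.

End Counting.

(** * From pairs to d families *)

Lemma prod_le_eq (I : finType) (x y : I -> nat) :
    (forall i, 0 < y i)%N -> (forall i, x i <= y i)%N ->
    (\prod_i y i <= \prod_i x i)%N ->
  forall i, x i = y i.
Proof.
move=> y0 lexy leyx i; apply/eqP; rewrite eqn_leq lexy /= leqNgt.
apply: contraL leyx => ltxy; rewrite -ltnNge (bigD1 i) //= [ltnRHS](bigD1 i) //=.
apply: (@leq_ltn_trans (x i * \prod_(j | j != i) y j)).
  by rewrite leq_mul2l leq_prod ?orbT.
by rewrite ltn_mul2r ltxy andbT; apply: prodn_gt0.
Qed.

Local Open Scope fset_scope.

(* Families are indexed 0..d-1 (so m 0 = m_1, m 1 = m_2). *)
Theorem theorem3p3 (F : finFieldType) (nu : nat) (A : 'M[F]_(2 * nu))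
  (d t : nat) (m : nat -> nat)
  (Fam : nat -> {fset {vspace 'rV[F]_(2 * nu)}}) :
  sp_alternating A -> sp_nondegenerate A ->
  (2 <= d)%N -> (0 < nu)%N -> (0 < t)%N ->
  (forall i, (i < d)%N -> (0 < m i)%N) ->
  (forall i j, (i <= j < d)%N -> (m j <= m i)%N) ->
  (forall i, (i < d)%N -> (t <= m i)%N) ->
  (2 * m 0 + m 1 + 1 <= 2 * nu)%N ->
  (forall i, (i < d)%N -> forall W, W \in Fam i -> in_P A (m i) W) ->
  (forall Fs : nat -> {vspace 'rV[F]_(2 * nu)},
      (forall i, (i < d)%N -> Fs i \in Fam i) ->
      (t <= \dim (\bigcap_(i < d) Fs i))%N) ->
  (forall G : nat -> {fset {vspace 'rV[F]_(2 * nu)}},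
      (forall i, (i < d)%N -> forall W, W \in G i -> in_P A (m i) W) ->
      (forall Fs : nat -> {vspace 'rV[F]_(2 * nu)},
          (forall i, (i < d)%N -> Fs i \in G i) ->
          (t <= \dim (\bigcap_(i < d) Fs i))%N) ->
      (\prod_(i < d) #|` G i| <= \prod_(i < d) #|` Fam i|)%N) ->
  exists T : {vspace 'rV[F]_(2 * nu)},
    in_P A t T /\
    forall i, (i < d)%N -> forall W,
      W \in Fam i <-> (in_P A (m i) W /\ (T <= W)%VS).
Proof.
move=> altA Au d2 nu_gt0 t_gt0 m_gt0 mS letm len FamP FamC Fammax.
have [T0 iT0 dT0] : exists2 T : {vspace 'rV[F]_(2 * nu)}, isob A T & \dim T = t.
  have le2t : (2 * t <= 2 * nu)%N by have := letm 0%N; lia.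
  have i0 : isob A (0%VS : {vspace 'rV[F]_(2 * nu)}) by apply: sub0v.
  have [T] : exists T, T \in star A t 0%VS.
    apply/card_gt0P; rewrite -(ltr0n rat) card_star //; last by rewrite dimv0.
    exact: nstar_gt0.
  by rewrite !inE => /andP[/andP[iT /eqP dT] _]; exists T.
(* For i = 0 use m j <= m 1; for i > 0, 2 m i + m j <= 2 m 1 + m 0 <= 2 m 0 + m 1. *)
have len2 i j : (i < d)%N -> (j < d)%N -> i != j ->
    (2 * m i + m j + 1 <= 2 * nu)%N.
  move=> id jd nij; have m1 := mS 0%N 1%N.
  have [i0|i0] := posnP i.
    by have := mS 1%N j; rewrite i0 in nij *; lia.
  by have := mS 1%N i; have := mS 0%N j; lia.
have len1 i : (i < d)%N -> (2 * m i + 1 <= 2 * nu)%N.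
  move=> id; have := len2 i (if i == 0 then 1 else 0)%N id.
  by case: eqVneq => [->|i0] H; have := H; lia.
pose G i := [set W | W \in Fam i].
have cG i : #|` Fam i| = #|G i|.
  rewrite -(card_finset (mem (G i))); congr #|` _|.
  by apply/fsetP => W; rewrite !inE.
have inP k W : in_P A k W <-> W \in isotropics A k.
  rewrite inE; split=> [[iW ->]|/andP[/isobP iW /eqP dW]]; last by [].
  by rewrite eqxx andbT; apply/isobP.
have sG i : (i < d)%N -> G i \subset isotropics A (m i).
  by move=> id; apply/subsetP => W; rewrite inE => /(FamP _ id)/inP.
have cstar i T : (i < d)%N -> isob A T -> \dim T = t ->
    #|star A (m i) T|%:R = nstar F (2 * nu) (m i) t.
  move=> id iT dT; have := len1 _ id; have := letm _ id => ? ?.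
  by rewrite card_star ?dT //; lia.
pose b i := #|star A (m i) T0|.
have b_gt0 i : (i < d)%N -> (0 < b i)%N.
  move=> id; rewrite -(ltr0n rat) cstar //; apply: nstar_gt0.
  by have := len1 _ id; lia.
(* Maximality against the d stars above [T0], an admissible choice because all their members contain
   [T0]. *)
have geb : (\prod_(i < d) b i <= \prod_(i < d) #|G i|)%N.
  have -> : (\prod_(i < d) #|G i| = \prod_(i < d) #|` Fam i|)%N.
    by apply: eq_bigr => i _; rewrite cG.
  pose S i := [fset W in star A (m i) T0].
  have cS i : #|` S i| = b i by rewrite card_finset.
  have -> : (\prod_(i < d) b i = \prod_(i < d) #|` S i|)%N.
    by apply: eq_bigr => i _; rewrite cS.
  apply: Fammax.
    by move=> i id W; rewrite !inE => /andP[+ _]; move=> H; apply/inP; rewrite inE.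
  move=> Fs FsS; rewrite -dT0; apply: dimvS; apply/subv_bigcapP => i _.
  by have := FsS i (ltn_ord i); rewrite !inE => /andP[].
have G_gt0 i : (i < d)%N -> (0 < #|G i|)%N.
  move=> id; have : (0 < \prod_(i < d) #|G i|)%N.
    apply: leq_trans geb; apply: prodn_gt0 => j; exact: b_gt0.
  by rewrite (bigD1 (Ordinal id)) //= muln_gt0 => /andP[].
(* The default is never reached for i < d, where [G i] is nonempty. *)
pose P i := odflt 0%VS [pick W in G i].
have PG i : (i < d)%N -> P i \in G i.
  move=> /G_gt0/card_gt0P[W GW]; rewrite /P; case: pickP => // /(_ W).
  by rewrite GW.
have crossG i j : (i < d)%N -> (j < d)%N -> i != j -> cross t (G i) (G j).
  move=> id jd nij V W GV GW.
  (* Complete V and W by arbitrary members elsewhere; the total intersection lies in V :&: W. *)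
  pose Fs x := if x == i then V else if x == j then W else P x.
  have /leq_trans -> // : (t <= \dim (\bigcap_(i < d) Fs i))%N.
    apply: FamC => x xd; rewrite /Fs.
    case: eqP => [->|_]; first by move: GV; rewrite inE.
    case: eqP => [->|_]; first by move: GW; rewrite inE.
    by have := PG _ xd; rewrite inE.
  apply: dimvS; rewrite subv_cap; apply/andP; split.
    by have := bigcapv_inf (Ordinal id); apply; rewrite // /Fs eqxx.
  by have := bigcapv_inf (Ordinal jd); apply; rewrite // /Fs eq_sym (negbTE nij) eqxx.
have pair i j : (i < d)%N -> (j < d)%N -> i != j ->
    (#|G i| * #|G j| <= b i * b j)%N /\ ((#|G i| * #|G j|)%N = (b i * b j)%N ->
     exists T, [/\ isob A T, \dim T = t, G i = star A (m i) T & G j = star A (m j) T]).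
  move=> id jd nij; have nji : j != i by rewrite eq_sym.
  have [le eq] := cross_pair altA Au (sG _ id) (sG _ jd) (crossG _ _ id jd nij)
    (letm _ id) (letm _ jd) (len2 _ _ id jd nij) (len2 _ _ jd id nji)
    (PG _ id) (PG _ jd).
  rewrite -(cstar i T0) // -(cstar j T0) // -!natrM ler_nat in le eq.
  by split=> // e; apply: eq; rewrite e.
(* The cyclic successor differs from i because d >= 2, also at the wrap from d - 1 to 0. *)
have nS (i : 'I_d) : i != ordS i :> nat.
  rewrite /=; have [lt|ge] := ltnP i.+1 d; first by rewrite modn_small //; lia.
  have -> : i.+1 = d by have := ltn_ord i; lia.
  by rewrite modnn; have := ltn_ord i; lia.
have prodS (x : nat -> nat) :
    (\prod_(i < d) (x i * x (ordS i)) = (\prod_(i < d) x i) * \prod_(i < d) x i)%N.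
  rewrite big_split /=; congr muln.
  by rewrite [RHS](reindex_inj (@ordS_inj d)).
(* In the cyclic product every index occurs twice, so [geb] squared makes all the pairwise bounds
   tight at once. *)
have pairE (i : 'I_d) : (#|G i| * #|G (ordS i)|)%N = (b i * b (ordS i))%N.
  apply: (@prod_le_eq _ (fun i : 'I_d => #|G i| * #|G (ordS i)|)%N
    (fun i : 'I_d => b i * b (ordS i))%N) => [j|j|].
  - by rewrite muln_gt0 !b_gt0.
  - exact: (pair j (ordS j) _ _ (nS j)).1.
  by rewrite (prodS (fun i => #|G i|)) (prodS b) leq_mul.
have next i : (i < d)%N -> (i.+1 < d)%N -> exists T,
    [/\ isob A T, \dim T = t, G i = star A (m i) T & G i.+1 = star A (m i.+1) T].
  move=> id Sid; have := pairE (Ordinal id); rewrite /= modn_small //.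
  by apply: (pair i i.+1 id Sid _).2; rewrite neq_ltn ltnSn.
have [T [iT dT G0 _]] := next 0%N (ltnW d2) d2.
exists T; split; first by split; [apply/isobP|].
(* Consecutive pairs share the family [G i], so [star_inj] identifies their t-spaces. *)
have GT i : (i < d)%N -> G i = star A (m i) T.
  elim: i => // i IHi Sid; have id := ltnW Sid.
  have [T' [iT' dT' eT' ->]] := next _ id Sid; congr star.
  rewrite (IHi id) in eT'; apply/esym; apply: star_inj eT' => //.
  - exact: len1.
  - by rewrite dT letm.
  - by rewrite dT.
move=> i id W; have := GT _ id; move=> /setP/(_ W).
rewrite [LHS]inE [RHS]inE => ->.
by split=> [/andP[/inP PW TW]|[/inP PW TW]]; [split|apply/andP].
Qed.
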